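(* Let $\mathsf{allSys}^{\mathsf{ef}}$ be the category of all dynamical systems with embedding-factor pairs as morphisms, and let $\mathsf{S}^{\mathsf{ef}}$ be a full subcategory of $\mathsf{allSys}^{\mathsf{ef}}$ such that: (1) If $\big((X_i,T_i),(e_{i\,i+1},f_{i\,i+1})\big)_{i\in\omega}$ is an $\omega$-chain in $\mathsf{S}^{\mathsf{ef}}$, then $(X,T)$ is again in $\mathsf{S}^{\mathsf{ef}}$, where $$X:=\Big\{\langle x_i:i\in\omega\rangle\in\prod_{i\in\omega}X_i:\ f_{ij}(x_j)=x_i\text{ for all }i\leq j\Big\}$$ carries the subspace topology of the product topology, $f_i:X\to X_i$ are the canonical projections, and $T(x):=\{x'\in X:\forall i\in\omega.\ f_i(x)\xrightarrow{T_i}f_i(x')\}$. (2) If $(X,T)$ is in $\mathsf{S}^{\mathsf{ef}}$ and $f:X\to Y$ is a continuous surjection onto a finite discrete space $Y$, then $(Y,S)$ is in $\mathsf{S}^{\mathsf{ef}}$, where $S:=f\circ T\circ f^{-1}$, i.e. $S(y)=\{y'\in Y:\exists x,x'\in X.\ y=f(x),\ x\xrightarrow{T}x',\ f(x')=y'\}$. Then $\mathsf{S}^{\mathsf{ef}}$ is algebroidal, and its category-theoretically finite objects are precisely those systems in $\mathsf{S}^{\mathsf{ef}}$ that have a finite state space.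
   Context: Multifunctions. A multifunction $F:X\rightrightarrows Y$ assigns to each $x\in X$ a subset $F(x)\subseteq Y$; write $x\xrightarrow{F}y$ for $y\in F(x)$ and $F[A]=\bigcup_{x\in A}F(x)$; composition is $(G\circ F)(x)=G[F(x)]$; functions are identified with singleton-valued multifunctions. $F$ is total if every $F(x)\neq\emptyset$; partition-injective if $F(x)\cap F(x')=\emptyset$ for $x\neq x'$ and every $y\in Y$ lies in some $F(x)$; closed-valued if every $F(x)$ is closed; upper-hemicontinuous if for every $x$ and open $V\supseteq F(x)$ there is an open $U\ni x$ with $F(x')\subseteq V$ for all $x'\in U$. Dynamical systems. A dynamical system is a pair $(X,T)$ with $X$ a zero-dimensional, second-countable, compact Hausdorff space and $T:X\rightrightarrows X$ a closed-valued, upper-hemicontinuous multifunction. Morphisms. A system morphism $\varphi:(X,T)\to(Y,S)$ is a closed-valued, upper-hemicontinuous multifunction $\varphi:X\rightrightarrows Y$ such that (i) if $x\xrightarrow{T}x'$, there are $y,y'$ with $x\xrightarrow{\varphi}y$, $x'\xrightarrow{\varphi}y'$, $y\xrightarrow{S}y'$; (ii) if $y\xrightarrow{S}y'$, there are $x,x'$ with $x\xrightarrow{\varphi}y$, $x'\xrightarrow{\varphi}y'$, $x\xrightarrow{T}x'$. It is a factor if it is a surjective function and (iii) whenever $x\xrightarrow{\varphi}y$ and $x\xrightarrow{T}x'$ there is $y'$ with $y\xrightarrow{S}y'$ and $x'\xrightarrow{\varphi}y'$. It is an embedding if it is total and partition-injective and (iv) whenever $x\xrightarrow{\varphi}y$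 and $y\xrightarrow{S}y'$ there is $x'$ with $x\xrightarrow{T}x'$ and $x'\xrightarrow{\varphi}y'$. An embedding-factor pair (ef-pair) $(e,f):(X,T)\to(Y,S)$ consists of an embedding $e:(X,T)\to(Y,S)$ and a factor $f:(Y,S)\to(X,T)$ with $f\circ e(x)=\{x\}$ for all $x$ and $y\in e\circ f(y)$ for all $y$. Composition: $(e',f')\circ(e,f)=(e'\circ e,f\circ f')$. Algebroidal categories. An $\omega$-chain in a category $\mathsf{C}$ is a sequence of objects $A_i$ with morphisms $f_{i\,i+1}:A_i\to A_{i+1}$ ($i\in\omega$). In a chain of ef-pairs, $f_{i\,i+1}:X_{i+1}\to X_i$ denotes the factor, and $f_{ij}:X_j\to X_i$ ($i\le j$) the composite of factors. An object $B$ of $\mathsf{C}$ is (category-theoretically) finite if for every $\omega$-chain with colimit $(A,f_i)$ and every morphism $g:B\to A$ there is $n$ such that for all $i\geq n$ there is a unique morphism $h:B\to A_i$ with $g=f_i\circ h$. $\mathsf{C}$ is semi-algebroidal if all its morphisms are monic, every object is a colimit of an $\omega$-chain of finite objects, and every $\omega$-chain of finite objects has a colimit in $\mathsf{C}$. $\mathsf{C}$ is algebroidal if it is semi-algebroidal, has up to isomorphism only countably many finite objects, and has only countably many morphisms between any two finite objects. *)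

(* Defs.v *)
From HB Require Import structures.
From mathcomp Require Import all_boot finmap.
From mathcomp Require Import all_classical topology.

Set Implicit Arguments.
Unset Strict Implicit.
Unset Printing Implicit Defensive.

Local Open Scope classical_set_scope.

Definition multifun (X Y : Type) := X -> set Y.

Definition mimage (X Y : Type) (F : multifun X Y) (A : set X) : set Y :=
  \bigcup_(x in A) F x.

Definition mcomp (X Y Z : Type) (G : multifun Y Z) (F : multifun X Y) :
  multifun X Z := fun x => mimage G (F x).

Definition mfun_of (X Y : Type) (f : X -> Y) : multifun X Y :=
  fun x => [set f x].

Definition mtotal (X Y : Type) (F : multifun X Y) := forall x, F x !=set0.

Definition partition_injective (X Y : Type) (F : multifun X Y) :=
  (forall x x', x <> x' -> F x `&` F x' = set0) /\
  (forall y, exists x, F x y).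

Definition closed_valued (X : Type) (Y : topologicalType) (F : multifun X Y) :=
  forall x, closed (F x).

Definition upper_hemicontinuous (X Y : topologicalType) (F : multifun X Y) :=
  forall x (V : set Y), open V -> F x `<=` V ->
    exists U : set X, [/\ open U, U x & forall x', U x' -> F x' `<=` V].

(* For maps into a compact Hausdorff space, being closed-valued and
   upper-hemicontinuous amounts to having a closed graph. *)
Lemma closed_graph (X Y : topologicalType) (F : multifun X Y) :
  hausdorff_space Y -> compact [set: Y] ->
  closed_valued F -> upper_hemicontinuous F ->
  forall x y, ~ F x y -> \forall x' \near x & y' \near y, ~ F x' y'.
Proof.
move=> hY cY clF uF x y nFxy.
have nb : nbhs y (~` F x).
  by apply: open_nbhs_nbhs; split => //; exact: closed_openC.
have [W Wy WF] := @compact_regular Y y setT hY cY filterT _ nb.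
have [U [oU Ux UF]] : exists U : set X,
    [/\ open U, U x & forall x', U x' -> F x' `<=` ~` closure W].
  apply: uF; first exact/closed_openC/closed_closure.
  by move=> z Fz /WF.
exists (U, W); first by split => //=; apply: open_nbhs_nbhs.
by move=> [x' y'] /= [Ux' Wy'] /(UF _ Ux'); apply; exact: subset_closure.
Qed.

Lemma closed_graph_valued (X Y : topologicalType) (F : multifun X Y) :
  (forall x y, ~ F x y -> \forall x' \near x & y' \near y, ~ F x' y') ->
  closed_valued F.
Proof.
move=> gF x; rewrite -[F x]setCK; apply: open_closedC; rewrite openE => y nF.
have [[U W] /= [Ux Wy] UW] := gF _ _ nF.
apply: filterS Wy => y' Wy'; apply: (UW (x, y')); split => //=.
exact: nbhs_singleton.
Qed.

Lemma closed_graph_uhc (X Y : topologicalType) (F : multifun X Y) :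
  compact [set: Y] ->
  (forall x y, ~ F x y -> \forall x' \near x & y' \near y, ~ F x' y') ->
  upper_hemicontinuous F.
Proof.
move=> cY gF x V oV FV.
have cV : compact (~` V).
  by apply: (subclosed_compact _ cY) => //; exact: open_closedC.
have /compact_near_coveringP cov := cV.
have H y : (~` V) y -> \forall y' \near y & x' \near x, ~ F x' y'.
  move=> nVy; have [[U W] /= [Ux Wy] UW] := gF x y (fun h => nVy (FV _ h)).
  by exists (W, U) => // -[y' x'] /= [? ?]; exact: (UW (x', y')).
have := cov X (nbhs x) (fun x' y' => ~ F x' y') (nbhs_filter x) H.
rewrite /= nbhsE => -[U [oU Ux] UF]; exists U; split => // x' Ux' y Fy.
by apply: contrapT => nVy; exact: (UF _ Ux' y nVy).
Qed.

Record category := Category {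
  ob :> Type;
  hom : ob -> ob -> Type;
  idm : forall A, hom A A;
  cmp : forall A B C, hom B C -> hom A B -> hom A C;
  cmp1m : forall A B (f : hom A B), cmp (idm B) f = f;
  cmpm1 : forall A B (f : hom A B), cmp f (idm A) = f;
  cmpA : forall A B C D (h : hom C D) (g : hom B C) (f : hom A B),
    cmp h (cmp g f) = cmp (cmp h g) f }.

Arguments idm {c} A.

Definition full_subcategory (C : category) (P : C -> Prop) : category :=
  @Category {A : C | P A} (fun A B => hom (sval A) (sval B))
    (fun A => idm (sval A)) (fun A B D g f => cmp g f)
    (fun A B => @cmp1m C (sval A) (sval B))
    (fun A B => @cmpm1 C (sval A) (sval B))
    (fun A B D E => @cmpA C (sval A) (sval B) (sval D) (sval E)).

Section Algebroidal.
Variable C : category.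

Definition monic (A B : C) (f : hom A B) :=
  forall (D : C) (g h : hom D A), cmp f g = cmp f h -> g = h.

Definition isomorphic (A B : C) :=
  exists (f : hom A B) (g : hom B A), cmp g f = idm A /\ cmp f g = idm B.

Record omega_chain := OmegaChain {
  chain_ob :> nat -> C;
  chain_hom : forall i, hom (chain_ob i) (chain_ob i.+1) }.

Definition cocone (c : omega_chain) (A : C) (f : forall i, hom (c i) A) :=
  forall i, cmp (f i.+1) (chain_hom c i) = f i.

Definition colimit (c : omega_chain) (A : C) (f : forall i, hom (c i) A) :=
  cocone f /\
  forall (B : C) (g : forall i, hom (c i) B), cocone g ->
    exists! u : hom A B, forall i, cmp u (f i) = g i.

Definition cat_finite (B : C) :=
  forall (c : omega_chain) (A : C) (f : forall i, hom (c i) A),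
    colimit f -> forall g : hom B A,
    exists n, forall i, (n <= i)%N -> exists! h : hom B (c i), g = cmp (f i) h.

Definition semi_algebroidal :=
  [/\ forall (A B : C) (f : hom A B), monic f,
      forall A : C, exists (c : omega_chain) (f : forall i, hom (c i) A),
        (forall i, cat_finite (c i)) /\ colimit f &
      forall c : omega_chain, (forall i, cat_finite (c i)) ->
        exists (A : C) (f : forall i, hom (c i) A), colimit f].

(* Representatives of the finite objects are listed by a sequence in [option C]
   because C may be empty; [set C] is excluded by universe constraints when the
   objects of C are themselves topological spaces. *)
Definition algebroidal :=
  [/\ semi_algebroidal,
      exists F : nat -> option C, forall B, cat_finite B ->
        exists n A, F n = Some A /\ isomorphic A B &
      forall A B : C, cat_finite A -> cat_finite B ->
        countable [set: hom A B]].

End Algebroidal.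

Record is_dynsys (X : topologicalType) (T : multifun X X) : Prop := IsDynsys {
  dyn_zero_dimensional : zero_dimensional X;
  dyn_second_countable : @second_countable X;
  dyn_compact : compact [set: X];
  dyn_hausdorff : hausdorff_space X;
  dyn_closed : closed_valued T;
  dyn_uhc : upper_hemicontinuous T }.

(* [zero_dimensional] only asks for clopen sets separating points; in a compact
   Hausdorff space this is the same as having a basis of clopen sets. *)
Lemma zero_dimensional_basis (X : topologicalType) :
  compact [set: X] -> hausdorff_space X ->
  zero_dimensional X <-> basis (@clopen X).
Proof.
move=> cX hX; split=> [zX|[_ bX] x y xy].
  split=> [U [] //|x]; have := zero_dimensional_cvg hX zX cX.
  move=> /(_ x) zc U /zc [D [Dx cD] DU]; exists D => //.
have : nbhs x (~` [set y]).
  apply: open_nbhs_nbhs; split; last exact/eqP.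
  apply: closed_openC; apply: accessible_closed_set1.
  exact: hausdorff_accessible.
by move/bX => [U [cU Ux] Uy]; exists U; split => // /Uy; exact.
Qed.

Record dynsys := DynSys {
  state :> topologicalType;
  trans : multifun state state;
  dynsysP : is_dynsys trans }.

Section Morphisms.
Variables X Y : dynsys.

Record is_sysmor (phi : multifun X Y) : Prop := IsSysmor {
  sysmor_closed : closed_valued phi;
  sysmor_uhc : upper_hemicontinuous phi;
  sysmor_fwd : forall x x', trans x x' ->
    exists y y', [/\ phi x y, phi x' y' & trans y y'];
  sysmor_bwd : forall y y', trans y y' ->
    exists x x', [/\ phi x y, phi x' y' & trans x x'] }.

Record is_factor (f : X -> Y) : Prop := IsFactor {
  factor_sysmor : is_sysmor (mfun_of f);
  factor_surj : forall y, exists x, f x = y;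
  factor_lift : forall x y x', mfun_of f x y -> trans x x' ->
    exists y', trans y y' /\ mfun_of f x' y' }.

Record is_embedding (e : multifun X Y) : Prop := IsEmbedding {
  emb_sysmor : is_sysmor e;
  emb_total : mtotal e;
  emb_pinj : partition_injective e;
  emb_lift : forall x y y', e x y -> trans y y' ->
    exists x', trans x x' /\ e x' y' }.

End Morphisms.

(* A factor is a function, so composites involving it go through [mfun_of]. *)
Record efpair (X Y : dynsys) := EFPair {
  emb : multifun X Y;
  fac : Y -> X;
  emb_embedding : is_embedding emb;
  fac_factor : is_factor fac;
  fac_emb : forall x, mcomp (mfun_of fac) emb x = [set x];
  emb_fac : forall y, mcomp emb (mfun_of fac) y y }.

Lemma efpair_eq (X Y : dynsys) (p q : efpair X Y) :
  emb p = emb q -> fac p = fac q -> p = q.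
Proof.
case: p q => [e f H1 H2 H3 H4] [e' f' H1' H2' H3' H4'] /= ee ff.
subst e' f'; congr EFPair; exact: Prop_irrelevance.
Qed.

Lemma continuous_uhc (X Y : topologicalType) (f : X -> Y) :
  continuous f <-> upper_hemicontinuous (mfun_of f).
Proof.
split=> [/continuousP cf x V oV fV|uf].
  exists (f @^-1` V); split=> //; first exact: cf.
    exact: fV.
  by move=> x' Vx' _ ->.
apply/continuousP => V oV; rewrite openE => x Vfx.
have [|U [oU Ux UV]] := uf x V oV; first by move=> _ ->.
apply: (@filterS _ _ _ U); last exact: open_nbhs_nbhs.
by move=> x' Ux'; exact: (UV _ Ux').
Qed.

Section Identity.
Variable X : dynsys.

Lemma id_sysmor : is_sysmor (mfun_of (@id X)).
Proof.
split.
- move=> x; apply: accessible_closed_set1; apply: hausdorff_accessible.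
  exact: dyn_hausdorff (dynsysP X).
- by apply/continuous_uhc => x.
- by move=> x x' xx'; exists x, x'.
- by move=> x x' xx'; exists x, x'.
Qed.

Lemma id_factor : is_factor (@id X).
Proof.
split; first exact: id_sysmor.
- by move=> y; exists y.
- by move=> x _ x' -> xx'; exists x'.
Qed.

Lemma id_embedding : is_embedding (mfun_of (@id X)).
Proof.
split; first exact: id_sysmor.
- by move=> x; exists x.
- split=> [x x' xx'|y]; last by exists y.
  by rewrite -subset0 => y [/= -> /xx'].
- by move=> x _ x' -> xx'; exists x'.
Qed.

Lemma id_fac_emb x : mcomp (mfun_of (@id X)) (mfun_of (@id X)) x = [set x].
Proof. by rewrite /mcomp /mimage /mfun_of bigcup_set1. Qed.

Lemma id_emb_fac x : mcomp (mfun_of (@id X)) (mfun_of (@id X)) x x.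
Proof. by rewrite id_fac_emb. Qed.

Definition efid : efpair X X :=
  EFPair id_embedding id_factor id_fac_emb id_emb_fac.

End Identity.

Section Composition.
Variables X Y Z : dynsys.

Lemma mcomp_closed_graph (G : multifun Y Z) (F : multifun X Y) :
  is_sysmor F -> is_sysmor G ->
  forall x z, ~ mcomp G F x z -> \forall x' \near x & z' \near z,
    ~ mcomp G F x' z'.
Proof.
have [_ _ cY hY _ _] := dynsysP Y; have [_ _ cZ hZ _ _] := dynsysP Z.
move=> [cF uF _ _] [cG uG _ _] x z nGF.
have /compact_near_coveringP cov := cY.
have H y : [set: Y] y ->
    \forall y' \near y & p \near filter_prod (nbhs x) (nbhs z),
      ~ (F p.1 y' /\ G y' p.2).
  move=> _; have [nF|nG] : ~ F x y \/ ~ G y z.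
    by apply/not_andP => -[Fxy Gyz]; apply: nGF; exists y.
  - have [[U W] /= [Ux Wy] UW] := closed_graph hY cY cF uF nF.
    exists (W, U `*` setT).
      by split => //=; exists (U, setT) => //; split => //; exact: filterT.
    by move=> [y' [x' z']] /= [Wy' [Ux' _]] [+ _]; apply: (UW (x', y')).
  - have [[U W] /= [Uy Wz] UW] := closed_graph hZ cZ cG uG nG.
    exists (U, setT `*` W).
      by split => //=; exists (setT, W) => //; split => //; exact: filterT.
    by move=> [y' [x' z']] /= [Uy' [_ Wz']] [_]; apply: (UW (y', z')).
have := cov _ _ (fun p y => ~ (F p.1 y /\ G y p.2))
  (filter_prod_filter (nbhs_filter x) (nbhs_filter z)) H.
by apply: filterS => -[x' z'] /= K [y Fy Gy]; exact: (K y I).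
Qed.

Lemma mcomp_sysmor (G : multifun Y Z) (F : multifun X Y) :
  is_sysmor F -> is_sysmor G -> is_sysmor (mcomp G F).
Proof.
move=> mF mG; have gGF := mcomp_closed_graph mF mG; split.
- exact: closed_graph_valued.
- by apply: closed_graph_uhc => //; exact: dyn_compact (dynsysP Z).
- move=> x x' /(sysmor_fwd mF) [y [y' [xy xy' /(sysmor_fwd mG)]]].
  by move=> [z [z' [yz yz' zz']]]; exists z, z'; split => //; [exists y|exists y'].
- move=> z z' /(sysmor_bwd mG) [y [y' [yz yz' /(sysmor_bwd mF)]]].
  by move=> [x [x' [xy xy' xx']]]; exists x, x'; split => //; [exists y|exists y'].
Qed.

Lemma mcomp_embedding (G : multifun Y Z) (F : multifun X Y) :
  is_embedding F -> is_embedding G -> is_embedding (mcomp G F).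
Proof.
move=> [mF tF [dF sF] lF] [mG tG [dG sG] lG]; split.
- exact: mcomp_sysmor.
- by move=> x; have [y xy] := tF x; have [z yz] := tG y; exists z, y.
- split=> [x x' xx'|z]; last first.
    by have [y yz] := sG z; have [x xy] := sF y; exists x, y.
  rewrite -subset0 => z [[y xy yz] [y' xy' yz']].
  have yy' : y = y'.
    by apply: contrapT => /dG; rewrite -subset0 => /(_ z); apply.
  by subst y'; have := dF _ _ xx'; rewrite -subset0 => /(_ y); apply.
- move=> x z z' [y xy yz] zz'; have [y' [yy' yz']] := lG _ _ _ yz zz'.
  have [x' [xx' xy']] := lF _ _ _ xy yy'.
  by exists x'; split => //; exists y'.
Qed.

Lemma mfun_of_comp (g : Y -> Z) (f : X -> Y) :
  mfun_of (g \o f) = mcomp (mfun_of g) (mfun_of f).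
Proof. by apply/funext => x; rewrite /mcomp /mimage /mfun_of bigcup_set1. Qed.

Lemma comp_factor (g : Y -> Z) (f : X -> Y) :
  is_factor f -> is_factor g -> is_factor (g \o f).
Proof.
move=> [mf sf lf] [mg sg lg]; split.
- by rewrite mfun_of_comp; exact: mcomp_sysmor.
- by move=> z; have [y <-] := sg z; have [x <-] := sf y; exists x.
- move=> x z x' xz /(lf x (f x) x' erefl)[y' [yy' fy']].
  rewrite [y']fy' in yy'; rewrite [z]xz.
  exact: (lg (f x) (g (f x)) (f x') erefl yy').
Qed.

End Composition.

Lemma emb_fac_fac (X Y : dynsys) (p : efpair X Y) x y :
  emb p x y -> fac p y = x.
Proof.
by move=> xy; have := fac_emb p x; move/seteqP => [+ _]; apply; exists y.
Qed.

Lemma emb_facE (X Y : dynsys) (p : efpair X Y) y : emb p (fac p y) y.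
Proof. by have [x] := emb_fac p y; rewrite /mfun_of /= => ->. Qed.

Section EFComposition.
Variables (X Y Z : dynsys) (q : efpair Y Z) (p : efpair X Y).

Lemma efcomp_fac_emb x :
  mcomp (mfun_of (fac p \o fac q)) (mcomp (emb q) (emb p)) x = [set x].
Proof.
apply/seteqP; split=> [_ [z [y xy yz] ->]|_ ->] /=.
  by rewrite (emb_fac_fac yz) (emb_fac_fac xy).
have [y xy] := emb_total (emb_embedding p) x.
have [z yz] := emb_total (emb_embedding q) y.
exists z; first by exists y.
by rewrite /mfun_of /= (emb_fac_fac yz) (emb_fac_fac xy).
Qed.

Lemma efcomp_emb_fac z :
  mcomp (mcomp (emb q) (emb p)) (mfun_of (fac p \o fac q)) z z.
Proof.
exists (fac p (fac q z)) => //; exists (fac q z); exact: emb_facE.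
Qed.

Definition efcomp : efpair X Z :=
  EFPair (mcomp_embedding (emb_embedding p) (emb_embedding q))
    (comp_factor (fac_factor q) (fac_factor p)) efcomp_fac_emb efcomp_emb_fac.

End EFComposition.

Lemma mcompA (X Y Z W : Type) (H : multifun Z W) (G : multifun Y Z)
  (F : multifun X Y) : mcomp H (mcomp G F) = mcomp (mcomp H G) F.
Proof.
apply/funext => x; apply/seteqP; split=> w.
  by move=> [z [y xy yz] zw]; exists y => //; exists z.
by move=> [y xy [z yz zw]]; exists z => //; exists y.
Qed.

Lemma mcomp1f (X Y : Type) (F : multifun X Y) : mcomp (mfun_of id) F = F.
Proof.
apply/funext => x; apply/seteqP; split=> [y [_ xy -> //]|y xy].
by exists y.
Qed.

Lemma mcompf1 (X Y : Type) (F : multifun X Y) : mcomp F (mfun_of id) = F.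
Proof.
by apply/funext => x; rewrite /mcomp /mimage /mfun_of bigcup_set1.
Qed.

Lemma efcomp1m (X Y : dynsys) (p : efpair X Y) : efcomp (efid Y) p = p.
Proof. by apply: efpair_eq => //=; exact: mcomp1f. Qed.

Lemma efcompm1 (X Y : dynsys) (p : efpair X Y) : efcomp p (efid X) = p.
Proof. by apply: efpair_eq => //=; exact: mcompf1. Qed.

Lemma efcompA (X Y Z W : dynsys) (r : efpair Z W) (q : efpair Y Z)
  (p : efpair X Y) : efcomp r (efcomp q p) = efcomp (efcomp r q) p.
Proof. by apply: efpair_eq => //=; exact: mcompA. Qed.

Definition allSys_ef : category :=
  @Category dynsys efpair efid efcomp efcomp1m efcompm1 efcompA.

Section Limit.
Variable c : omega_chain allSys_ef.

(* Retyped from [ob allSys_ef] to [dynsys], so that it coerces to its space. *)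
Definition chain_sys (i : nat) : dynsys := c i.

(* The composite f_(i,j) : X_j -> X_i, with i <= j encoded as j = k + i. *)
Fixpoint chain_fac (i k : nat) : chain_sys (k + i) -> chain_sys i :=
  if k isn't k'.+1 then id
  else fun x => chain_fac (fac (chain_hom c (k' + i)) x).

Definition lim_set : set (prod_topology chain_sys) :=
  [set x : forall i, chain_sys i | forall i k, chain_fac (x (k + i)%N) = x i].

Definition lim_trans : multifun lim_set lim_set :=
  fun x => [set x' | forall i, trans (set_val x i) (set_val x' i)].

End Limit.

Arguments lim_set : clear implicits.

Lemma prod_second_countable (K : nat -> topologicalType) :
  (forall i, @second_countable (K i)) -> @second_countable (prod_topology K).
Proof.
move=> sK; pose B i := s2val (cid2 (sK i)).
have cB i : countable (B i) := s2valP (cid2 (sK i)).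
have bB i : basis (B i) := s2valP' (cid2 (sK i)).
pose sub : set (set (prod_topology K)) :=
  \bigcup_i [set (fun x : prod_topology K => x i) @^-1` U | U in B i].
have osub i U : B i U ->
    open ((fun x : prod_topology K => x i) @^-1` U).
  move=> BU; apply: open_comp; last by have [+ _] := bB i; exact.
  by move=> x _; exact: (@proj_continuous _ K i).
exists (finI_from sub id).
  apply/finI_from_countable/bigcup_countable => // i _.
  by apply: sub_countable (cB i); exact: card_image_le.
split=> [_ [D Dsub <-]|x].
  rewrite openE => x Dx; apply: filter_bigI => E DE.
  apply: open_nbhs_nbhs; split; last exact: Dx.
  by have /set_mem[i _ [U BU <-]] := Dsub _ DE; exact: osub.
set F := filter_from _ _.
have FF : Filter F.
  apply: filter_from_filter.
    exists setT; split => //; exists fset0; first by [].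
    by rewrite set_fset0 bigcap_set0.
  move=> U V [U1 Ux] [V1 Vx]; exists (U `&` V) => //; split; last by split.
  exact: finI_fromI.
apply/cvg_sup => i A [_ [[W oW <-] Wx WA]].
have [_ /(_ (x i) W (open_nbhs_nbhs (conj oW Wx)))[U [BU Ux] UW]] := bB i.
exists ((fun x : prod_topology K => x i) @^-1` U); last by move=> y /UW /WA.
by split => //; apply: finI_from1; exists i => //; exists U.
Qed.

Lemma initial_second_countable (S : choiceType) (T : topologicalType)
  (f : S -> T) : @second_countable T -> @second_countable (initial_topology f).
Proof.
move=> [B cB [oB bB]]; exists [set f @^-1` U | U in B].
  by apply: sub_countable cB; exact: card_image_le.
split=> [_ [U BU <-]|x A [_ [[W oW <-] Wx WA]]]; first by exists U => //; exact: oB.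
have [U [BU Ux] UW] := bB (f x) W (open_nbhs_nbhs (conj oW Wx)).
by exists (f @^-1` U); [split=> //; exists U|move=> y /UW /WA].
Qed.

Section Subtype.
Variables (T : topologicalType) (A : set T).

Lemma set_val_continuous : continuous (set_val : A -> T).
Proof. exact: initial_continuous. Qed.

Lemma subtype_hausdorff : hausdorff_space T -> hausdorff_space A.
Proof.
move=> hT x y xy; apply: val_inj; apply: hT => U V Ux Vy.
have [z [Uz Vz]] := xy _ _ (set_val_continuous Ux) (set_val_continuous Vy).
by exists (set_val z).
Qed.

Lemma subtype_zero_dimensional : zero_dimensional T -> zero_dimensional A.
Proof.
move=> zT x y xy; have [|U [cU Ux Uy]] := zT (val x) (val y).
  by apply: contra xy => /eqP/val_inj ->.
exists (set_val @^-1` U); split => //.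
by apply: preimage_clopen => //; exact: set_val_continuous.
Qed.

Lemma subtype_compact : compact A -> compact [set: A].
Proof.
move=> cA F PF _.
have FA : (set_val @ F) A.
  by apply: (@filterS _ F _ setT); [move=> z _; exact: set_valP|exact: filterT].
have [p [Ap pF]] := cA (set_val @ F) (fmap_proper_filter set_val PF) FA.
exists (exist _ p (mem_set Ap)); split => // U V FU [_ [[W oW <-] Wp WV]].
have FU' : (set_val @ F) (set_val @` U).
  by apply: (@filterS _ F _ U) => // z Uz; exists z.
have [_ [[z Uz <-] Wz]] := pF _ W FU' (open_nbhs_nbhs (conj oW Wp)).
by exists z; split => //; exact: WV.
Qed.

End Subtype.

Section LimitSystem.
Variable c : omega_chain allSys_ef.

Lemma chain_fac_continuous i k : continuous (@chain_fac c i k).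
Proof.
elim: k => [|k IH] /=; first by move=> x.
have cf : continuous (fac (chain_hom c (k + i))).
  by apply/continuous_uhc/sysmor_uhc/factor_sysmor/fac_factor.
by move=> x; apply: continuous_comp; [exact: cf|exact: IH].
Qed.

Lemma prod_proj_continuous i :
  continuous (fun x : prod_topology (chain_sys c) => x i).
Proof. exact: (@proj_continuous _ (chain_sys c) i). Qed.

Lemma lim_set_closed : closed (lim_set c).
Proof.
pose E i k : set (prod_topology (chain_sys c)) :=
  [set x : forall i, chain_sys c i | chain_fac (x (k + i)%N) = x i].
have -> : lim_set c = \bigcap_i \bigcap_k E i k.
  by apply/seteqP; split=> [x h i _ k _|x h i k]; [exact: h|exact: h].
apply: closed_bigI => i _; apply: closed_bigI => k _.
rewrite -[E i k]setCK; apply: open_closedC; rewrite openE => x /eqP xE.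
have [U [[oU clU] Ux nUx]] := dyn_zero_dimensional (dynsysP (chain_sys c i)) xE.
have N1 : nbhs x [set y : prod_topology (chain_sys c) |
    U (chain_fac (y (k + i)%N))].
  have := @chain_fac_continuous i k (x (k + i)%N) _ (open_nbhs_nbhs (conj oU Ux)).
  exact: (@prod_proj_continuous (k + i)%N x).
have N2 : nbhs x [set y : prod_topology (chain_sys c) | ~ U (y i)].
  have nU : nbhs (x i) (~` U).
    by apply: open_nbhs_nbhs; split => //; exact: closed_openC.
  exact: (@prod_proj_continuous i x _ nU).
by apply: filterS (filterI N1 N2) => y [/= U1 U2] Ey; apply: U2; rewrite -Ey.
Qed.

Lemma prod_chain_compact : compact [set: prod_topology (chain_sys c)].
Proof.
have := @tychonoff nat (chain_sys c) (fun i => setT)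
  (fun i => dyn_compact (dynsysP (chain_sys c i))).
by congr (compact _); apply/seteqP; split.
Qed.

Lemma lim_compact : compact [set: lim_set c].
Proof.
apply: subtype_compact; apply: subclosed_compact prod_chain_compact _ => //.
exact: lim_set_closed.
Qed.

Lemma lim_proj_continuous i : continuous (fun x : lim_set c => set_val x i).
Proof.
move=> x U /(@prod_proj_continuous i (set_val x)) nU.
exact: (@set_val_continuous _ (lim_set c) x _ nU).
Qed.

Lemma lim_trans_graph (x y : lim_set c) : ~ lim_trans x y ->
  \forall x' \near x & y' \near y, ~ lim_trans x' y'.
Proof.
move=> /existsNP[i nT].
have [_ _ cX hX cT uT] := dynsysP (chain_sys c i).
have [[U W] /= [Ux Wy] UW] := closed_graph hX cX cT uT nT.
exists ((fun x : lim_set c => set_val x i) @^-1` U,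
        (fun x : lim_set c => set_val x i) @^-1` W).
  by split; [exact: (@lim_proj_continuous i x _ Ux)
            |exact: (@lim_proj_continuous i y _ Wy)].
by move=> [x' y'] /= [Ux' Wy'] /(_ i); apply: (UW (_, _)).
Qed.

Lemma lim_is_dynsys : is_dynsys (@lim_trans c).
Proof.
split.
- apply: subtype_zero_dimensional; apply: (@zero_dimension_prod nat (chain_sys c)).
  by move=> i; exact: dyn_zero_dimensional (dynsysP (chain_sys c i)).
- apply: initial_second_countable; apply: (@prod_second_countable (chain_sys c)).
  by move=> i; exact: dyn_second_countable (dynsysP (chain_sys c i)).
- exact: lim_compact.
- apply: subtype_hausdorff; apply: (@hausdorff_product nat (chain_sys c)).
  by move=> i; exact: dyn_hausdorff (dynsysP (chain_sys c i)).
- by apply: closed_graph_valued => x y; exact: lim_trans_graph.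
- by apply: closed_graph_uhc lim_compact _ => x y; exact: lim_trans_graph.
Qed.

Definition lim_sys : dynsys := DynSys lim_is_dynsys.

End LimitSystem.

Section Quotient.
Variables (X : dynsys) (Y : discreteTopologicalType) (f : X -> Y).

Definition quot_trans : multifun Y Y :=
  fun y => [set y' | exists x x', [/\ y = f x, trans x x' & f x' = y']].

Lemma quot_is_dynsys : finite_set [set: Y] -> is_dynsys quot_trans.
Proof.
move=> fY; split.
- exact: discrete_zero_dimension.
- exists (range (@set1 Y)).
    by apply: finite_set_countable; exact: finite_image.
  split=> [_ [y _ <-]|y A /nbhs_singleton Ay]; first exact: discrete_open.
  by exists [set y]; [split => //; exists y|move=> _ ->].
- exact: finite_compact.
- exact: discrete_hausdorff.
- by move=> y; exact: discrete_closed.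
- move=> y V _ yV; exists [set y]; split => //; first exact: discrete_open.
  by move=> _ ->.
Qed.

Definition quot_sys (fY : finite_set [set: Y]) : dynsys :=
  DynSys (quot_is_dynsys fY).

End Quotient.

(* Main.v *)
Require Import Defs.
From mathcomp Require Import all_boot.
From mathcomp Require Import all_classical topology.

(* The embedding of an ef-pair is the fibre map of its factor, so an ef-pair
   X -> Y is nothing but a continuous surjection f : Y -> X for which the
   transitions of X are the images of those of Y.  Hence a cocone whose factors
   jointly separate points is a colimit, by compactness, and the inverse limit
   is one.  A map to a finite system has a clopen kernel, which by compactness
   contains the kernel of one of the factors of a colimit; so finite systems
   are category-theoretically finite.  Every system is the colimit of its
   quotients by finitely many members of a countable family of clopen sets
   separating points, and if it is category-theoretically finite, then its
   identity factors through one of these finite quotients. *)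

Set Implicit Arguments.
Unset Strict Implicit.
Unset Printing Implicit Defensive.

Local Open Scope classical_set_scope.

(** * Compactness and closed sets *)

(** Were the intersection empty, each point would have a neighbourhood missing some [Q m], hence all
    later ones, and compactness would make a single [Q N] empty. *)
Lemma nested_closed (X : topologicalType) (Q : nat -> set X) :
  compact [set: X] -> (forall n, closed (Q n)) ->
  (forall n, Q n.+1 `<=` Q n) -> (forall n, Q n !=set0) ->
  exists x, forall n, Q n x.
Proof.
move=> cX clQ decQ Q0; apply: contrapT => /forallNP noQ.
have mono m k : Q (k + m)%N `<=` Q m by elim: k => // k IH x /decQ/IH.
have /compact_near_coveringP cov := cX.
have [|N _ NQ] := cov nat \oo (fun n x => ~ Q n x) _.
  move=> x _; have /existsNP[m nQm] := noQ x.
  exists (~` Q m, [set n | (m <= n)%N]).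
    split; last by exists m.
    by apply: open_nbhs_nbhs; split => //; exact: closed_openC.
  by move=> [y n] /= [nQy mn]; rewrite -(subnK mn) => /mono.
by have [x Qx] := Q0 N; exact: (NQ N (leqnn N) x I Qx).
Qed.

Lemma equalizer_closed (X Y : topologicalType) (f g : X -> Y) :
  hausdorff_space Y -> continuous f -> continuous g ->
  closed [set x | f x = g x].
Proof.
move=> hY cf cg x clx; apply: hY => U V fU gV.
have fU' : nbhs x (f @^-1` U) := cf x U fU.
have gV' : nbhs x (g @^-1` V) := cg x V gV.
have [y [/= fg [Uy Vy]]] := clx _ (filterI fU' gV').
by exists (f y); split => //; rewrite fg.
Qed.

Lemma trans_closed (X : dynsys) : closed [set p : X * X | trans p.1 p.2].
Proof.
have [_ _ cX hX cT uT] := dynsysP X.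
rewrite -[X in closed X]setCK; apply: open_closedC; rewrite openE => -[x y] nT.
by apply: filterS (closed_graph hX cX cT uT nT) => -[].
Qed.

(** * Ef-pairs as continuous surjections *)

Section EFPairs.
Variables X Y : dynsys.
Implicit Type p : efpair X Y.

Lemma fac_continuous p : continuous (fac p).
Proof. exact/continuous_uhc/sysmor_uhc/factor_sysmor/fac_factor. Qed.

Lemma fac_surj p x : exists y, fac p y = x.
Proof. exact: factor_surj (fac_factor p) x. Qed.

Lemma fac_trans p y y' : trans y y' -> trans (fac p y) (fac p y').
Proof.
move=> yy'; have [_ _ lf] := fac_factor p.
by have [x' [xx' x'E]] := lf y _ y' erefl yy'; rewrite -[fac p y']x'E.
Qed.

Lemma trans_fac p x x' : trans x x' ->
  exists y y', [/\ fac p y = x, fac p y' = x' & trans y y'].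
Proof.
move=> /(sysmor_bwd (factor_sysmor (fac_factor p)))[y [y' [-> -> yy']]].
by exists y, y'.
Qed.

(** [emb_fac_fac] and [emb_facE] make each embedding the fibre map of its factor, so the factor
    carries all the data. *)
Lemma efpair_eq_fac (p q : efpair X Y) : fac p =1 fac q -> p = q.
Proof.
move=> /funext pq; apply: efpair_eq => //.
apply/funext => x; apply/seteqP; split=> y.
  by move=> /emb_fac_fac <-; rewrite pq; exact: emb_facE.
by move=> /emb_fac_fac <-; rewrite -pq; exact: emb_facE.
Qed.

(* The embedding of an ef-pair is forced to be the fibre map of its factor. *)
Lemma efpair_of (f : Y -> X) :
  continuous f -> (forall x, exists y, f y = x) ->
  (forall y y', trans y y' -> trans (f y) (f y')) ->
  (forall x x', trans x x' ->
    exists y y', [/\ f y = x, f y' = x' & trans y y']) ->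
  {p : efpair X Y | fac p = f}.
Proof.
move=> cf sf fT Tf.
have [_ _ cX hX _ _] := dynsysP X; have [_ _ cY hY _ _] := dynsysP Y.
have clX x : closed [set x : X].
  by apply: accessible_closed_set1; exact: hausdorff_accessible.
pose e : multifun X Y := fun x => [set y | f y = x].
have eE : is_embedding e.
  split.
  - split.
    + by move=> x; apply: equalizer_closed => //; exact: cst_continuous.
    (* The neighbourhood consists of the points whose whole fibre lies in [V]; its complement is the
       image of a compact set, hence closed. *)
    + move=> x V oV eV; exists (~` (f @` ~` V)); split.
      * apply: closed_openC; apply: compact_closed => //.
        apply: continuous_compact; first exact: continuous_subspaceT.
        by apply: (subclosed_compact _ cY) => //; exact: open_closedC.
      * by move=> [y nVy] /eV.
      * move=> x' nx' y fy; apply: contrapT => nVy; apply: nx'.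
        by exists y.
    + by move=> x x' /Tf[y [y' [<- <- yy']]]; exists y, y'.
    + by move=> y y' yy'; exists (f y), (f y'); split => //; exact: fT.
  - by move=> x; have [y] := sf x; exists y.
  - split=> [x x' xx'|y]; last by exists (f y).
    by rewrite -subset0 => y [/= fx fx']; apply: xx'; rewrite -fx -fx'.
  - by move=> x y y' <- yy'; exists (f y'); split => //; exact: fT.
have fF : is_factor f.
  split => //.
  - split.
    + by move=> y; exact: clX.
    + exact/continuous_uhc.
    + by move=> y y' yy'; exists (f y), (f y'); split => //; exact: fT.
    + by move=> x x' /Tf[y [y' [<- <- yy']]]; exists y, y'.
  - by move=> y _ y' -> yy'; exists (f y'); split => //; exact: fT.
have fe x : mcomp (mfun_of f) e x = [set x].
  apply/seteqP; split=> [x' [y fy x'E]|_ ->]; first by rewrite -fy.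
  by have [y <-] := sf x; exists y.
have ef y : mcomp e (mfun_of f) y y by exists (f y).
by exists (EFPair eE fF fe ef).
Qed.

End EFPairs.

(** [fac q] is constant on the fibres of [fac p], so it descends through any section [s] of [fac p].
    The descended map is continuous because [fac p], going from a compact to a Hausdorff space, is
    closed. *)
Lemma efpair_factor (A B X : dynsys) (p : efpair B X) (q : efpair A X) :
  (forall x x', fac p x = fac p x' -> fac q x = fac q x') ->
  {h : efpair A B | q = efcomp p h}.
Proof.
move=> pq; have [s sE] := choice (fac_surj p).
have [_ _ cX hX _ _] := dynsysP X; have [_ _ cB hB _ _] := dynsysP B.
have spE x : fac q (s (fac p x)) = fac q x by apply: pq; rewrite sE.
have [||||h hE] := @efpair_of A B (fac q \o s).
- apply/continuous_closedP => V clV.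
  have -> : (fac q \o s) @^-1` V = fac p @` (fac q @^-1` V).
    apply/seteqP; split=> [b qb|_ [x qx <-]]; first by exists (s b).
    by rewrite /= spE.
  apply: compact_closed => //; apply: continuous_compact.
    by apply: continuous_subspaceT => x; exact: fac_continuous.
  apply: (subclosed_compact _ cX) => //.
  exact: (continuous_closedP _).1 (@fac_continuous _ _ q) _ clV.
- move=> a; have [x <-] := fac_surj q a.
  by exists (fac p x); rewrite /= spE.
- move=> b b' /(trans_fac p)[x [x' [<- <- xx']]] /=.
  by rewrite !spE; exact: fac_trans.
- move=> a a' /(trans_fac q)[x [x' [<- <- xx']]].
  exists (fac p x), (fac p x'); rewrite /= !spE; split => //.
  exact: fac_trans.
by exists h; apply: efpair_eq_fac => x; rewrite /= hE /= spE.
Qed.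

(** The factor of [f] is onto, so it suffices to compare the factors of [g] and [h] at points
    [fac f y]. *)
Lemma efpair_monic (X Y : allSys_ef) (f : hom X Y) : monic f.
Proof.
move=> D g h fgh; apply: efpair_eq_fac => x.
have [y <-] := fac_surj f x.
by have := congr1 (fun p : efpair D Y => fac p y) fgh.
Qed.

(** * Threads and the inverse limit of a chain *)

(** Used for points, with [Q] everything, and for pairs, with [Q] the transition relation. [T] is
    arbitrary so that the induction on [i] can drop the lowest level. *)
Lemma thread_through (T : nat -> Type) (f : forall i, T i.+1 -> T i)
  (Q : forall i, set (T i)) :
  (forall i x, Q i.+1 x -> Q i (f i x)) ->
  (forall i x, Q i x -> exists2 y, Q i.+1 y & f i y = x) ->
  forall i x, Q i x ->
  exists t : forall j, T j,
    (forall j, Q j (t j) /\ f j (t j.+1) = t j) /\ t i = x.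
Proof.
move=> Qf fQ i; elim: i T f Q Qf fQ => [|i IH] T f Q Qf fQ x Qx.
  (* From level 0 the thread is built upwards by choosing lifts. *)
  pose up j (z : {z : T j | Q j z}) : {y : T j.+1 | Q j.+1 y} :=
    let w := cid2 (fQ j (sval z) (svalP z)) in exist _ (s2val w) (s2valP w).
  have upE j z : f j (sval (up j z)) = sval z by rewrite /up /=; case: cid2.
  pose t := fix t j : {z : T j | Q j z} :=
    if j is j'.+1 then up j' (t j') else exist _ x Qx.
  exists (fun j => sval (t j)); split => // j; split; first exact: svalP.
  exact: upE.
have [||t [tQ tx]] := IH (fun j => T j.+1) (fun j => f j.+1)
  (fun j => Q j.+1) _ _ x Qx.
- by move=> j y; exact: Qf.
- by move=> j y; exact: fQ.
(* The thread of the shifted sequence starts at level 1; its image under [f 0] supplies the missing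
   level 0. *)
exists (fun j => if j is j'.+1 then t j' else f 0%N (t 0%N)); split => // -[|j].
  by split => //; apply: Qf; exact: (tQ 0%N).1.
exact: tQ.
Qed.

Section ChainLimit.
Variable c : omega_chain allSys_ef.

Lemma lim_setP (t : forall i, chain_sys c i) :
  lim_set c t <-> forall i, fac (chain_hom c i) (t i.+1) = t i.
Proof.
split=> [ht i|ht i k]; first exact: ht i 1%N.
by elim: k => //= k IH; rewrite ht.
Qed.

Definition lim_point (t : forall i, chain_sys c i)
  (ht : forall i, fac (chain_hom c i) (t i.+1) = t i) : lim_sys c :=
  exist _ t (mem_set ((lim_setP t).2 ht)).

Lemma lim_fac (x : lim_sys c) i :
  fac (chain_hom c i) (set_val x i.+1) = set_val x i.
Proof. by apply: (lim_setP _).1; exact: set_valP. Qed.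

Lemma lim_eq (x y : lim_sys c) : (forall i, set_val x i = set_val y i) -> x = y.
Proof. by move=> xy; apply: val_inj; apply: functional_extensionality_dep. Qed.

Lemma lim_proj i : {p : efpair (chain_sys c i) (lim_sys c) |
  fac p = fun x : lim_set c => set_val x i}.
Proof.
apply: efpair_of.
- exact: lim_proj_continuous.
- move=> x; have [||t [tE tx]] := @thread_through (chain_sys c)
    (fun j => fac (chain_hom c j)) (fun j => setT) _ _ i x I.
  + by [].
  + by move=> j y _; have [z <-] := fac_surj (chain_hom c j) y; exists z.
  + by exists (lim_point (fun j => (tE j).2)).
- by move=> x x'; exact.
- move=> x x' xx'.
  (* Both ends of the transition are lifted together, as a thread of pairs, so that every level is
     again a transition. *)
  have [||t [tE tx]] := @thread_through
    (fun j => chain_sys c j * chain_sys c j)%type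
    (fun j z => (fac (chain_hom c j) z.1, fac (chain_hom c j) z.2))
    (fun j => [set z | trans z.1 z.2]) _ _ i (x, x') xx'.
  + by move=> j z; exact: fac_trans.
  + move=> j [y y'] /= /(trans_fac (chain_hom c j))[z [z' [<- <- zz']]].
    by exists (z, z').
  + have tE1 j : fac (chain_hom c j) (t j.+1).1 = (t j).1.
      by have [_ <-] := tE j.
    have tE2 j : fac (chain_hom c j) (t j.+1).2 = (t j).2.
      by have [_ <-] := tE j.
    exists (lim_point tE1), (lim_point tE2).
    split; [exact: (congr1 fst tx)|exact: (congr1 snd tx)|].
    by move=> j; exact: (tE j).1.
Qed.

Definition lim_pair i : @hom allSys_ef (c i) (lim_sys c) := sval (lim_proj i).

Lemma lim_pairE i (x : lim_sys c) : fac (lim_pair i) x = set_val x i.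
Proof. by rewrite /lim_pair; case: lim_proj => p /= ->. Qed.

Lemma lim_pair_cocone : cocone lim_pair.
Proof.
by move=> i; apply: efpair_eq_fac => x; rewrite /= !lim_pairE lim_fac.
Qed.

Section Cocone.
Variables (A : dynsys) (f : forall i, efpair (chain_sys c i) A).
Hypothesis ccf : @cocone allSys_ef c A f.

Lemma cocone_fac i a : fac (chain_hom c i) (fac (f i.+1) a) = fac (f i) a.
Proof. by rewrite -(ccf i). Qed.

(** The fibres of [fac (f i)] over the entries of [t] are nonempty, closed and decreasing in [i],
    and [A] is compact. *)
Lemma thread_preimage (t : lim_sys c) :
  exists a, forall i, fac (f i) a = set_val t i.
Proof.
have [_ _ cA hA _ _] := dynsysP A.
apply: (nested_closed (Q := fun i =>
  [set a | fac (f i) a = set_val t i])) => //.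
- move=> i; apply: equalizer_closed; last exact: cst_continuous.
    exact: dyn_hausdorff (dynsysP (chain_sys c i)).
  exact: fac_continuous.
- by move=> i a /= fa; rewrite -cocone_fac fa lim_fac.
- by move=> i; exact: fac_surj.
Qed.

(** The same compactness argument in [A * A], inside the closed set of transitions; nonemptiness at
    level [i] comes from lifting the transition there. *)
Lemma trans_thread_preimage (t t' : lim_sys c) : trans t t' ->
  exists a a', [/\ forall i, fac (f i) a = set_val t i,
    forall i, fac (f i) a' = set_val t' i & trans a a'].
Proof.
move=> tt'; have [_ _ cA hA _ _] := dynsysP A.
have cAA : compact [set: A * A].
  by rewrite -setXTT; exact: compact_setX.
have [|||[a a'] aa'] := nested_closed (Q := fun i =>
  [set p : A * A | trans p.1 p.2] `&`
  ([set p | fac (f i) p.1 = set_val t i] `&`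
   [set p | fac (f i) p.2 = set_val t' i])) cAA.
- move=> i; have hi := dyn_hausdorff (dynsysP (chain_sys c i)).
  apply: closedI; first exact: trans_closed.
  apply: closedI; apply: equalizer_closed => //; try exact: cst_continuous.
  + move=> p; apply: continuous_comp; first exact: cvg_fst.
    exact: fac_continuous.
  + move=> p; apply: continuous_comp; first exact: cvg_snd.
    exact: fac_continuous.
- move=> i [a a'] /= [aa' [fa fa']]; split => //.
  by split; rewrite /= -cocone_fac ?fa ?fa' lim_fac.
- move=> i; have [a [a' [fa fa' aa']]] := trans_fac (f i) (tt' i).
  by exists (a, a').
- exists a, a'; split=> [i|i|]; last by have [] := aa' 0%N.
    by have [_ []] := aa' i.
  by have [_ []] := aa' i.
Qed.

(** The factor of [u] sends a point of [A] to the thread of its images; the two preceding lemmas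
    make it onto and lift transitions. *)
Lemma lim_univ : {u : efpair (lim_sys c) A |
  forall i, efcomp u (lim_pair i) = f i}.
Proof.
have [_ _ cL hL _ _] := dynsysP (lim_sys c).
pose u a : lim_sys c := lim_point (fun i => cocone_fac i a).
have uE a i : set_val (u a) i = fac (f i) a by [].
have [||||p pu] := @efpair_of (lim_sys c) A u.
- apply/continuous_uhc/closed_graph_uhc => // a x /= xua.
  (* Off the graph some coordinate already differs, and differing there is an open condition. *)
  have [i xi] : exists i, fac (lim_pair i) x <> fac (f i) a.
    apply/existsNP => xE; apply: xua; apply: lim_eq => i.
    by rewrite -lim_pairE xE.
  pose E := [set p : A * lim_sys c | fac (lim_pair i) p.2 = fac (f i) p.1].
  have clE : closed E.
    apply: equalizer_closed.
    + exact: dyn_hausdorff (dynsysP (chain_sys c i)).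
    + move=> p; apply: continuous_comp; first exact: cvg_snd.
      exact: fac_continuous.
    + move=> p; apply: continuous_comp; first exact: cvg_fst.
      exact: fac_continuous.
  have : nbhs (a, x) (~` E).
    by apply: open_nbhs_nbhs; split => //; exact: closed_openC.
  apply: filterS => -[a' x'] /= h xE; apply: h.
  by rewrite [x']xE /E /= lim_pairE.
- by move=> t; have [a aE] := thread_preimage t; exists a; exact: lim_eq.
- by move=> a a' aa' i; exact: fac_trans.
- move=> t t' /trans_thread_preimage[a [a' [aE aE' aa']]].
  by exists a, a'; split => //; exact: lim_eq.
by exists p => i; apply: efpair_eq_fac => a; rewrite /= lim_pairE pu.
Qed.

End Cocone.

(** The comparison morphism [u] from the inverse limit has an injective factor, hence an inverse
    [h]. Mediating morphisms are then those out of the limit, precomposed with [h]. *)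
Lemma jointly_injective_colimit (A : dynsys)
    (f : forall i, efpair (chain_sys c i) A) :
  @cocone allSys_ef c A f ->
  (forall a a', (forall i, fac (f i) a = fac (f i) a') -> a = a') ->
  @colimit allSys_ef c A f.
Proof.
move=> ccf jf; split => // B g ccg.
have [u uf] := lim_univ ccf; have [v vg] := lim_univ ccg.
have [h uh] : {h : efpair A (lim_sys c) | efid A = efcomp u h}.
  apply: efpair_factor => a a' aa'; apply: jf => i.
  by rewrite -uf /= aa'.
have hu : efcomp h u = efid (lim_sys c).
  apply: (@efpair_monic _ _ u); rewrite [LHS]efcompA -uh [RHS]efcompm1.
  exact: efcomp1m.
exists (efcomp v h); split=> [i|w wg].
  by rewrite -uf -vg /= -efcompA [efcomp h _]efcompA hu efcomp1m.
(* For uniqueness, the factors of two mediating morphisms agree after every [fac (f i)], and joint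
   injectivity cancels these. *)
apply: efpair_eq_fac => b; apply: jf => i.
have E : efcomp (efcomp v h) (f i) = efcomp w (f i).
  by rewrite [RHS]wg -uf -efcompA [efcomp h _]efcompA hu efcomp1m vg.
by move/(congr1 (fun p : efpair (chain_sys c i) B => fac p b)): E.
Qed.

Lemma lim_colimit : @colimit allSys_ef c (lim_sys c) lim_pair.
Proof.
apply: jointly_injective_colimit => [|x y xy]; first exact: lim_pair_cocone.
by apply: lim_eq => i; rewrite -!lim_pairE.
Qed.

End ChainLimit.

(** * Finite systems and their codes *)

Lemma finite_dynsys_nbhs (X : dynsys) (x : X) :
  finite_set [set: X] -> nbhs x [set x].
Proof.
move=> fX; have [_ _ _ hX _ _] := dynsysP X.
apply: open_nbhs_nbhs; split => //; rewrite -[[set x]]setCK.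
apply: closed_openC.
apply: (accessible_finite_set_closed.1 (hausdorff_accessible hX)).
by apply: sub_finite_set fX.
Qed.

Lemma finite_dynsys_continuous (X : dynsys) (Y : topologicalType) (f : X -> Y) :
  finite_set [set: X] -> continuous f.
Proof.
move=> fX x U /nbhs_singleton Ufx.
by apply: filterS (finite_dynsys_nbhs x fX) => _ ->.
Qed.

(* [X] is coded by the number of its states and the list of its transitions,
   for some numbering of the states. *)
Definition dynsys_code (X : dynsys) (k : nat * seq (nat * nat)) :=
  exists phi : X -> nat, [/\ injective phi,
    forall a, (exists x, phi x = a) <-> (a < k.1)%N &
    forall x x', trans x x' <-> (phi x, phi x') \in k.2].

Lemma dynsys_code_exists (X : dynsys) :
  finite_set [set: X] -> exists k, dynsys_code X k.
Proof.
move=> /finite_seqP[s0 s0E]; pose s := undup s0.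
have sX x : x \in s by rewrite mem_undup; have : [set: X] x by []; rewrite s0E.
pose phi x := index x s.
pose tr p := `[< exists x x', [/\ phi x = p.1, phi x' = p.2 & trans x x'] >].
exists (size s, [seq p <- [seq (phi x, phi x') | x <- s, x' <- s] | tr p]).
exists phi; have phiI : injective phi.
  move=> x x' xx'; rewrite -(nth_index x (sX x)) -(nth_index x (sX x')).
  by rewrite -/(phi x) xx'.
split=> // [a|x x'] /=.
  split=> [[x <-]|sa]; first by rewrite index_mem.
  (* A default state for [nth]: a position below [size s] exists, so [s] is not empty. *)
  have [x0 _] : exists x0 : X, True by case: (s) sa => // x; exists x.
  by exists (nth x0 s a); rewrite /phi index_uniq // undup_uniq.
rewrite mem_filter; split=> [xx'|]; last first.
  by move=> /andP[/asboolP[y [y' [/phiI -> /phiI -> //]]]].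
apply/andP; split; first by apply/asboolP; exists x, x'.
by apply/allpairsP; exists (x, x').
Qed.

(** Matching states with equal numbers is a bijection respecting transitions both ways. Exchanging
    [X] and [Y] yields the inverse morphism. *)
Lemma dynsys_code_efpair (X Y : dynsys) (k : nat * seq (nat * nat))
  (phi : X -> nat) (psi : Y -> nat) :
  finite_set [set: Y] -> injective phi -> injective psi ->
  (forall a, (exists x, phi x = a) <-> (a < k.1)%N) ->
  (forall a, (exists x, psi x = a) <-> (a < k.1)%N) ->
  (forall x x', trans x x' <-> (phi x, phi x') \in k.2) ->
  (forall x x', trans x x' <-> (psi x, psi x') \in k.2) ->
  exists p : efpair X Y, forall y, phi (fac p y) = psi y.
Proof.
move=> fY phiI psiI phik psik phiT psiT.
have /choice[f fE] : forall y, exists x, phi x = psi y.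
  by move=> y; apply/phik/psik; exists y.
have [||||p pf] := @efpair_of X Y f.
- exact: finite_dynsys_continuous.
- move=> x; have /psik[y yx] : (phi x < k.1)%N by apply/phik; exists x.
  by exists y; apply: phiI; rewrite fE.
- by move=> y y' yy'; apply/phiT; rewrite !fE; exact/psiT.
- move=> x x' /phiT xx'.
  have /psik[y yx] : (phi x < k.1)%N by apply/phik; exists x.
  have /psik[y' yx'] : (phi x' < k.1)%N by apply/phik; exists x'.
  exists y, y'; split; try by apply: phiI; rewrite fE.
  by apply/psiT; rewrite yx yx'.
by exists p => y; rewrite pf.
Qed.

Lemma dynsys_code_isomorphic (X Y : dynsys) k :
  finite_set [set: X] -> finite_set [set: Y] ->
  dynsys_code X k -> dynsys_code Y k -> @isomorphic allSys_ef X Y.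
Proof.
move=> fX fY [phi [phiI phik phiT]] [psi [psiI psik psiT]].
have [p pE] := dynsys_code_efpair fY phiI psiI phik psik phiT psiT.
have [q qE] := dynsys_code_efpair fX psiI phiI psik phik psiT phiT.
exists p, q; split; apply: efpair_eq_fac => x.
  by apply: phiI; rewrite /= pE qE.
by apply: psiI; rewrite /= qE pE.
Qed.

(** An ef-pair is determined by its factor, and the factor by the list of the numbers of its values
    on the finitely many states of [Y]. *)
Lemma countable_efpair (X Y : dynsys) :
  finite_set [set: X] -> finite_set [set: Y] -> countable [set: efpair X Y].
Proof.
move=> /dynsys_code_exists[k [phi [phiI _ _]]] /finite_seqP[s sY].
apply/countable_injP; exists (fun p => pickle [seq phi (fac p y) | y <- s]).
move=> p q _ _ /(pcan_inj pickleK)/eq_in_map pq.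
apply: efpair_eq_fac => y; apply: phiI; apply: pq.
by have : [set: Y] y by []; rewrite sY.
Qed.

(** * Separating clopen sets and finite quotients *)

(** One clopen set is chosen for each pair of basic open sets that some clopen set separates. Pairs
    from a countable basis are countable, and any two distinct points lie in such a pair. *)
Lemma separating_clopens (X : dynsys) :
  exists D : nat -> set X, (forall n, clopen (D n)) /\
    forall x y, (forall n, D n x <-> D n y) -> x = y.
Proof.
have [zX [B cB bB] cX hX _ _] := dynsysP X.
have [oB nB] := bB.
have /countable_injP[e eI] := cB.
pose sep (n : nat) (D : set X) := clopen D /\ exists U V, [/\ B U, B V,
  unpickle n = Some (e U, e V), U `<=` D & V `<=` ~` D].
(* Where [n] codes no separable pair, the default is the empty set, which is clopen too. *)
pose D n := xget set0 (sep n).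
exists D; split=> [n|x y xy].
  rewrite /D; case: xgetP => [_ _ [] //|_].
  by split; [exact: open0|exact: closed0].
apply: contrapT => /eqP /zX[K [[oK clK] Kx nKy]].
have [U [BU Ux] UK] := nB x K (open_nbhs_nbhs (conj oK Kx)).
have [V [BV Vy] VK] := nB y (~` K)
  (open_nbhs_nbhs (conj (closed_openC clK) nKy)).
have : sep (pickle (e U, e V)) (D (pickle (e U, e V))).
  rewrite /D; case: xgetP => // /(_ K); case; split => //; exists U, V.
  by split => //; rewrite pickleK.
case=> _ [U' [V' [BU' BV']]]; rewrite pickleK => -[eU eV] UD VD.
have UU' : U = U' by apply: eI; rewrite ?inE.
have VV' : V = V' by apply: eI; rewrite ?inE.
subst U' V'.
by apply: (VD y Vy); apply/xy; exact: UD.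
Qed.

Lemma clopen_near (X : topologicalType) (D : set X) x :
  clopen D -> \forall x' \near x, D x' <-> D x.
Proof.
move=> [oD clD]; have [Dx|nDx] := pselect (D x).
  by apply: filterS (open_nbhs_nbhs (conj oD Dx)) => x' Dx'; split.
apply: filterS (open_nbhs_nbhs (conj (closed_openC clD) nDx)) => x' Dx'.
by split.
Qed.

Section FiniteQuotient.
Variables (X : dynsys) (I : finType) (D : I -> set X).
Hypothesis clD : forall i, clopen (D i).

Definition bits x : {ffun I -> bool} := [ffun i => `[< D i x >]].

Lemma bits_eq x x' : bits x = bits x' <-> forall i, D i x <-> D i x'.
Proof.
split=> [/ffunP xx' i|xx']; last first.
  by apply/ffunP => i; rewrite !ffunE; exact/asbool_equiv_eq.
by apply: asbool_eq_equiv; have := xx' i; rewrite !ffunE.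
Qed.

(** Membership in a clopen set is locally constant, and finiteness of [I] allows the neighbourhoods
    to be intersected. *)
Lemma bits_near x : \forall x' \near x, bits x' = bits x.
Proof.
have : \forall x' \near x, forall i, D i x' <-> D i x.
  by apply: filter_forall => i; exact: clopen_near.
by apply: filterS => x' xx'; exact/bits_eq.
Qed.

(** Only the bit vectors that occur are kept, so that [to_cell] is onto. *)
Definition cell := discrete_topology (range bits).

Definition to_cell x : cell := exist _ (bits x) (mem_set (imageT bits x)).

Lemma to_cell_eq x x' : to_cell x = to_cell x' <-> bits x = bits x'.
Proof. by split=> [[]|xx']; last exact/val_inj. Qed.

Lemma to_cell_continuous : continuous to_cell.
Proof.
move=> x U /nbhs_singleton Ux; apply: filterS (bits_near x) => x' /to_cell_eq.
by rewrite /= => ->.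
Qed.

Lemma to_cell_surj y : exists x, to_cell x = y.
Proof.
by case: y => y yb; have /set_mem[x _ xy] := yb; exists x; apply: val_inj.
Qed.

Lemma cell_finite : finite_set [set: cell].
Proof.
have -> : [set: cell] = (@set_val _ (range bits)) @^-1` setT by [].
by apply: finite_preimage; [move=> ? ? _ _ /val_inj|exact: finite_finset].
Qed.

Definition cell_sys : dynsys := quot_sys to_cell cell_finite.

Lemma cell_pair : {p : efpair cell_sys X | fac p = to_cell}.
Proof.
apply: efpair_of.
- exact: to_cell_continuous.
- exact: to_cell_surj.
- by move=> x x' xx'; exists x, x'.
- by move=> y y' [x [x' [-> xx' <-]]]; exists x, x'.
Qed.

End FiniteQuotient.

(** * Full subcategories closed under limits and finite quotients *)

Definition ambient_chain (C : category) (P : C -> Prop)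
    (c : omega_chain (full_subcategory P)) : omega_chain C :=
  @OmegaChain C (fun i => sval (c i)) (fun i => chain_hom c i).

(** By fullness the mediating morphisms stay available, and there are only fewer cocones to test. *)
Lemma full_subcategory_colimit (C : category) (P : C -> Prop)
    (c : omega_chain (full_subcategory P)) (A : full_subcategory P)
    (f : forall i, hom (c i) A) :
  @colimit C (ambient_chain c) (sval A) f -> colimit f.
Proof. by move=> [ccf univ]; split=> // B g; exact: univ. Qed.

Section SubcategoryOfSystems.
Variables (P : allSys_ef -> Prop).
Hypothesis P_lim : forall c : omega_chain allSys_ef,
  (forall i, P (c i)) -> P (lim_sys c).
Hypothesis P_quot : forall (X : dynsys) (Y : discreteTopologicalType)
  (f : X -> Y) (finY : finite_set [set: Y]),
  P X -> continuous f -> (forall y, exists x, f x = y) -> P (quot_sys f finY).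

Local Notation S := (full_subcategory P).

Definition sub_lim (c : omega_chain S) : S :=
  exist _ (lim_sys (ambient_chain c))
    (@P_lim (ambient_chain c) (fun i => svalP (c i))).

Lemma sub_lim_colimit (c : omega_chain S) :
  @colimit S c (sub_lim c) (@lim_pair (ambient_chain c)).
Proof. exact/full_subcategory_colimit/lim_colimit. Qed.

(** By [P_lim] the inverse limit is a competing cocone, which gives a morphism [u] from [A] to it.
    Its factor is onto, so each point of [A] is the image of the thread of its own coordinates. *)
Lemma colimit_jointly_injective (c : omega_chain S) (A : S)
    (f : forall i, hom (c i) A) : colimit f ->
  forall a a' : state (sval A),
    (forall i, fac (f i) a = fac (f i) a') -> a = a'.
Proof.
move=> [ccf univ] a a' aa'.
have [u [uf _]] := univ _ _ (sub_lim_colimit c).1.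
have [x xa] := fac_surj u a; have [x' xa'] := fac_surj u a'.
rewrite -xa -xa'; congr (fac u _); apply: lim_eq => i.
by rewrite -!lim_pairE -!uf /= xa xa'.
Qed.

Lemma finite_state_cat_finite (B : S) :
  finite_set [set: state (sval B)] -> cat_finite B.
Proof.
move=> fB c A f colf g; have jf := colimit_jointly_injective colf.
have fE i a : fac (chain_hom c i) (fac (f i.+1) a) = fac (f i) a.
  by rewrite -(colf.1 i).
have cA := dyn_compact (dynsysP (sval A)).
have cAA : compact [set: sval A * sval A].
  by rewrite -setXTT; exact: compact_setX.
(* [Q n] holds the pairs identified at level [n] but separated by [g]. A pair in all of them would
   contradict joint injectivity, so some [Q n] is empty, and from there on [g] factors. *)
pose Q n : set (sval A * sval A) :=
  [set p | fac (f n) p.1 = fac (f n) p.2] `&` [set p | fac g p.1 <> fac g p.2].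
have decQ n : Q n.+1 `<=` Q n.
  by move=> [a a'] /= [aa' ?]; split => //=; rewrite -(fE n a) -(fE n a') aa'.
have clQ n : closed (Q n).
  apply: closedI.
    apply: equalizer_closed.
    - exact: dyn_hausdorff (dynsysP (sval (c n))).
    - move=> p; apply: continuous_comp; first exact: cvg_fst.
      exact: fac_continuous.
    - move=> p; apply: continuous_comp; first exact: cvg_snd.
      exact: fac_continuous.
  apply: open_closedC; rewrite openE => -[a a'] /= aa'.
  (* The finite state space of [B] is discrete, so the fibres of [fac g] are open. *)
  have na b : nbhs b [set x | fac g x = fac g b].
    exact: (@fac_continuous _ _ g b _ (finite_dynsys_nbhs _ fB)).
  exists ([set x | fac g x = fac g a], [set x | fac g x = fac g a']).
    by split; exact: na.
  by move=> [x x'] /= [-> ->].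
have [n nQ] : exists n, ~ (Q n !=set0).
  apply/existsNP => neQ; have [[a a'] aa'] := nested_closed cAA clQ decQ neQ.
  have [_] := aa' 0%N; apply; congr (fac g _); apply: jf => i.
  by have [] := aa' i.
exists n => i ni.
have [h gh] : {h : efpair (sval B) (sval (c i)) | g = efcomp (f i) h}.
  apply: efpair_factor => a a' aa'; apply: contrapT => gaa'; apply: nQ.
  have mono k : Q (k + n)%N `<=` Q n by elim: k => // k IH x /decQ/IH.
  by exists (a, a'); apply: (mono (i - n)%N); rewrite subnK.
exists h; split=> // h' gh'; apply: (@efpair_monic _ _ (f i)).
exact: etrans (esym gh) gh'.
Qed.

(** Level [i] is the quotient by the first [i] separating clopen sets: the kernels decrease with [i]
    and jointly separate points. *)
Lemma finite_approximation (A : S) :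
  exists (c : omega_chain S) (f : forall i, hom (c i) A),
    (forall i, finite_set [set: state (sval (c i))]) /\ colimit f.
Proof.
have [D [clD sepD]] := separating_clopens (sval A).
have PX i : P (cell_sys (fun k : 'I_i => D k)).
  apply: P_quot; first exact: svalP.
    exact: to_cell_continuous.
  exact: to_cell_surj.
pose X i : S := exist _ _ (PX i).
pose f i : @hom S (X i) A := sval (cell_pair (fun k : 'I_i => clD k)).
have fE i : fac (f i) = to_cell (fun k : 'I_i => D k).
  by rewrite /f; case: cell_pair.
have cellE i a a' : fac (f i) a = fac (f i) a' <->
    forall k : 'I_i, D k a <-> D k a'.
  by rewrite fE to_cell_eq bits_eq.
have step i : {h : @hom S (X i) (X i.+1) | f i = @cmp S _ _ _ (f i.+1) h}.
  apply: efpair_factor => a a' /cellE aa'; apply/cellE => k.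
  exact: (aa' (widen_ord (leqnSn i) k)).
pose c := @OmegaChain S X (fun i => sval (step i)).
exists c, f; split; first by move=> i; exact: cell_finite.
apply: full_subcategory_colimit; apply: jointly_injective_colimit.
  by move=> i; exact: esym (svalP (step i)).
move=> a a' aa'; apply: sepD => n.
(* [D n] is the last of the first [n.+1] sets, so it is decided at level [n.+1]. *)
exact: (cellE n.+1 a a').1 (aa' n.+1) ord_max.
Qed.

(** The identity of [B] factors through a finite level, so the factor onto that level is
    injective. *)
Lemma cat_finite_finite_state (B : S) :
  cat_finite B -> finite_set [set: state (sval B)].
Proof.
have [c [f [fc colf]]] := finite_approximation B.
move=> /(_ _ _ _ colf (idm B))[n /(_ n (leqnn n))[h [hE _]]].
have hK b : fac h (fac (f n) b) = b.
  exact: esym (congr1 (fun p : efpair (sval B) (sval B) => fac p b) hE).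
have -> : [set: state (sval B)] = fac (f n) @^-1` setT by [].
apply: finite_preimage => // b b' _ _ bb'.
by rewrite -(hK b) bb' hK.
Qed.

(** Codes are countable and determine finite systems up to isomorphism, so one representative per
    code suffices; [None] stands for numbers that code no finite system of the subcategory. *)
Lemma countably_many_finite : exists F : nat -> option S, forall B,
  cat_finite B -> exists n A, F n = Some A /\ isomorphic A B.
Proof.
pose good n (A : S) := finite_set [set: state (sval A)] /\
  exists2 k, unpickle n = Some k & dynsys_code (sval A) k.
exists (fun n => if pselect (exists A, good n A) is left e
                 then Some (sval (cid e)) else None).
move=> B /cat_finite_finite_state fB.
have [k Bk] := dynsys_code_exists fB; exists (pickle k).
case: pselect => [e|[]]; last first.
  by exists B; split => //; exists k => //; rewrite pickleK.
case: cid => A [fA [k']] /=; rewrite pickleK => -[<-] Ak.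
by exists A; split=> //; apply: dynsys_code_isomorphic Ak Bk.
Qed.

Lemma sub_algebroidal : algebroidal S.
Proof.
split; last 2 first.
- exact: countably_many_finite.
- move=> A B /cat_finite_finite_state fA /cat_finite_finite_state fB.
  exact: countable_efpair.
split.
- by move=> A B f D g h; exact: efpair_monic.
- move=> A; have [c [f [fc colf]]] := finite_approximation A.
  by exists c, f; split => // i; exact: finite_state_cat_finite.
- move=> c _; exists (sub_lim c), (@lim_pair (ambient_chain c)).
  exact: sub_lim_colimit.
Qed.

End SubcategoryOfSystems.

Unset Implicit Arguments.

Theorem theorem6p2 (P : allSys_ef -> Prop)
  (P_lim : forall c : omega_chain allSys_ef,
    (forall i, P (c i)) -> P (lim_sys c))
  (P_quot : forall (X : dynsys) (Y : discreteTopologicalType) (f : X -> Y)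
    (finY : finite_set [set: Y]),
    P X -> continuous f -> (forall y, exists x, f x = y) ->
    P (quot_sys f finY)) :
  algebroidal (full_subcategory P) /\
  forall X : full_subcategory P,
    cat_finite X <-> finite_set [set: state (sval X)].
Proof.
split; first exact: sub_algebroidal.
move=> X; split; first exact: cat_finite_finite_state.
exact: finite_state_cat_finite.
Qed.
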